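(* Let $A,B\in 2^\omega$. Then $A\le_T B$ if and only if for all $X\in 2^\omega$, $\dim_{si\Delta^0_1(A)}(X)\le \dim_{si\Delta^0_1(B)}(X)$.
   Context: $K(\sigma)$ denotes prefix-free Kolmogorov complexity and $X\upharpoonright n$ the first $n$ bits of $X$. For an oracle $A$, $\dim_{si\Delta^0_1(A)}(X)=\sup_{N}\inf_{n\in N} K(X\upharpoonright n)/n$, where the supremum ranges over all infinite subsets $N\subseteq\omega$ that are computable from $A$. *)

(* Defs.v *)
From mathcomp Require Import all_boot all_order all_algebra.
From mathcomp Require Import all_classical all_reals all_analysis.

Set Implicit Arguments.
Unset Strict Implicit.
Unset Printing Implicit Defensive.

Local Open Scope classical_set_scope.

(* Kleene's schemata for the n-ary partial recursive functions in an oracle. *)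
Inductive recf : nat -> Type :=
| Zero n : recf n
| Succ : recf 1
| Proj n (i : 'I_n) : recf n
| Oracle : recf 1
| Comp m n (f : recf m) (g : 'I_m -> recf n) : recf n
| PrimRec n (f : recf n) (g : recf n.+2) : recf n.+1
| Mu n (f : recf n.+1) : recf n.

(* [recf_eval A e v y]: the partial function e, run with oracle A, is defined at v
   with value y.  Recursion and minimisation are on the first argument; the
   recursion step g receives (k, value at k, parameters).  In [Mu], f must be
   defined (and non-zero) at every i below the returned y. *)
Fixpoint recf_eval (A : nat -> bool) n (e : recf n) : n.-tuple nat -> nat -> Prop :=
  match e in recf n return n.-tuple nat -> nat -> Prop with
  | Zero _ => fun _ y => y = 0
  | Succ => fun v y => y = (thead v).+1
  | Proj _ i => fun v y => y = tnth v i
  | Oracle => fun v y => y = A (thead v)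
  | Comp m _ f g => fun v y =>
      exists w : m.-tuple nat,
        (forall i, recf_eval A (g i) v (tnth w i)) /\ recf_eval A f w y
  | PrimRec _ f g => fun v =>
      let ps := [tuple of behead v] in
      (fix loop (k y : nat) : Prop :=
         match k with
         | 0 => recf_eval A f ps y
         | k'.+1 => exists z, loop k' z /\ recf_eval A g [tuple of k' :: z :: ps] y
         end) (thead v)
  | Mu _ f => fun v y =>
      recf_eval A f [tuple of y :: v] 0 /\
      (forall i, i < y -> exists z, recf_eval A f [tuple of i :: v] z.+1)
  end.

(* Subsets of omega are identified with their characteristic functions. *)
Definition turing_le (A B : nat -> bool) : Prop :=
  exists e : recf 1, forall n, recf_eval B e [tuple n] (A n).

(* The bijection between binary strings and nat (bijective base 2, least
   significant digit first). *)
Fixpoint strcode (s : seq bool) : nat :=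
  if s is b :: s' then (b + (strcode s').*2).+1 else 0.

(* Partial functions on strings are given by their graphs. *)
Definition partial_computable (M : seq bool -> seq bool -> Prop) : Prop :=
  exists e : recf 1, forall p s,
    M p s <-> recf_eval (fun=> false) e [tuple strcode p] (strcode s).

Definition prefix_free_machine (M : seq bool -> seq bool -> Prop) : Prop :=
  partial_computable M /\
  (forall p q s t, M p s -> M q t -> prefix p q -> p = q).

Definition optimal_prefix_free_machine (U : seq bool -> seq bool -> Prop) :
    Prop :=
  prefix_free_machine U /\
  (forall M, prefix_free_machine M ->
    exists c : nat, forall p s, M p s ->
      exists q, U q s /\ size q <= size p + c).

(* Prefix-free complexity with respect to U; +oo if s has no U-description,
   which never happens for an optimal U. *)
Definition prefixK (R : realType) (U : seq bool -> seq bool -> Prop) (s : seq bool) :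
    \bar R :=
  ereal_inf [set ((size p)%:R : R)%:E | p in [set p | U p s]].

(* n = 0 is excluded from the infimum, K(X|0)/0 being undefined; the supremum
   is unaffected, since N may be replaced by N \ {0}. *)
Definition dim_si (R : realType) (U : seq bool -> seq bool -> Prop)
    (A X : nat -> bool) : \bar R :=
  ereal_sup
    [set ereal_inf [set (prefixK R U (mkseq X n) * ((n%:R : R)^-1)%R%:E)%E
                   | n in [set n : nat | N n /\ (0 < n)%N]]
    | N in [set N : nat -> bool | infinite_set [set n | N n] /\ turing_le N A]].

(* Main.v *)
Require Import Defs.
From mathcomp Require Import all_boot all_order all_algebra.
From mathcomp Require Import all_classical all_reals all_analysis.
From mathcomp Require Import zify.

(**
If A is Turing reducible to B, every A-computable N is B-computable, so the
dimension can only grow.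

Otherwise, cut omega into blocks [T k, T (k+1)) with T growing so fast that
T (k+1) is exponential in T k, and let S be the set of the codes of the initial
segments of A.  Let X be incompressible on [T k, 2 T k) for k in S, which a
counting argument allows, and zero elsewhere.  Then K(X|n)/n >= 1/2 on the
A-computable set of all n = 2 T k with k in S.  An infinite B-computable set N
has arbitrarily large elements in blocks of index k not in S, since otherwise
the indices of the blocks met by N would let B compute A.  For such an n, the
string X|n consists of 2 T (k-1) bits, logarithmically few, followed by zeros,
and 1^x 0 1^y 0 with n = 4 y + x, where x %/ 4 is the value of these bits, is a
self-delimiting description of it that, for large n, is shorter than 3 n / 8.
*)

Set Implicit Arguments.
Unset Strict Implicit.
Unset Printing Implicit Defensive.
Import Order.TTheory GRing.Theory Num.Theory.

Lemma recf_eval_functional (A : nat -> bool) n (e : recf n) v y z :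
  recf_eval A e v y -> recf_eval A e v z -> y = z.
Proof.
elim: n / e v y z => [n||n i||m n f IHf g IHg|n f IHf g IHg|n f IHf] v y z /=;
  try by move=> -> ->.
- move=> [w [Hw Hy]] [w' [Hw' Hz]].
  suff E : w = w' by subst w'; apply: IHf Hy Hz.
  by apply: eq_from_tnth => i; apply: IHg (Hw i) (Hw' i).
- elim: (thead v) y z => [|k IHk] y z; first exact: IHf.
  move=> [a [La Ha]] [b [Lb Hb]].
  by move: (IHk _ _ La Lb) => E; subst b; apply: IHg Ha Hb.
- move=> [y0 Hy] [z0 Hz]; case: (ltngtP y z) => // lt.
  + by have [u Hu] := Hz _ lt; have := IHf _ _ _ y0 Hu.
  + by have [u Hu] := Hy _ lt; have := IHf _ _ _ z0 Hu.
Qed.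

Fixpoint oracle_subst (d : recf 1) n (e : recf n) : recf n :=
  match e in recf n return recf n with
  | Oracle => d
  | Comp m n f g => Comp (oracle_subst d f) (fun i => oracle_subst d (g i))
  | PrimRec n f g => PrimRec (oracle_subst d f) (oracle_subst d g)
  | Mu n f => Mu (oracle_subst d f)
  | e' => e'
  end.

Lemma oracle_subst_eval (A B : nat -> bool) (d : recf 1) :
  (forall n, recf_eval B d [tuple n] (A n)) ->
  forall n (e : recf n) v y,
    recf_eval A e v y -> recf_eval B (oracle_subst d e) v y.
Proof.
move=> Hd n e; elim: n / e => [n||n i||m n f IHf g IHg|n f IHf g IHg|n f IHf] v y //=.
- case/tupleP: v => x v ->; rewrite theadE.
  have -> : [tuple of x :: v] = [tuple x] by apply: val_inj; rewrite /= (tuple0 v).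
  exact: Hd.
- by move=> [w [Hw Hy]]; exists w; split; [move=> i; apply: IHg|apply: IHf].
- elim: (thead v) y => [|k IHk] y; first exact: IHf.
  by move=> [z [Lz Hz]]; exists z; split; [apply: IHk|apply: IHg].
- move=> [H0 H]; split; first exact: IHf.
  by move=> i /H [z Hz]; exists z; apply: IHf.
Qed.

Lemma turing_le_trans (A B C : nat -> bool) :
  turing_le A B -> turing_le B C -> turing_le A C.
Proof.
move=> [e He] [d Hd]; exists (oracle_subst d e) => n.
exact: oracle_subst_eval Hd _ _ _ _ (He n).
Qed.

(** * Computable functions of an environment of variables *)

(* Functions of n variables take the list of the variables as argument, so
   that pushing a bound variable on the environment is [cons]. *)
Definition computable (A : nat -> bool) n (f : seq nat -> nat) : Prop :=
  exists e : recf n, forall v : n.-tuple nat, recf_eval A e v (f v).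

Section Computable.
Variable A : nat -> bool.
Local Notation comp := (computable A).

Lemma computable_ext n (f g : seq nat -> nat) :
  (forall v : n.-tuple nat, f v = g v) -> comp n f -> comp n g.
Proof. by move=> E [e He]; exists e => v; rewrite -E. Qed.

Lemma computable_nth n i : i < n -> comp n (fun v => nth 0 v i).
Proof. by move=> H; exists (Proj (Ordinal H)) => v /=; rewrite (tnth_nth 0). Qed.

Lemma computable_comp1 n (f : nat -> nat) g :
  comp 1 (fun v => f (nth 0 v 0)) -> comp n g -> comp n (fun v => f (g v)).
Proof.
move=> [e He] [d Hd]; exists (Comp e (fun=> d)) => v /=.
exists [tuple g v]; split; last exact: He [tuple g v].
by move=> i; rewrite (tnth_nth 0) ord1.
Qed.

Lemma computable_comp2 n (f : nat -> nat -> nat) g h :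
  comp 2 (fun v => f (nth 0 v 0) (nth 0 v 1)) -> comp n g -> comp n h ->
  comp n (fun v => f (g v) (h v)).
Proof.
move=> [e He] [d Hd] [d' Hd'].
exists (Comp e (fun i : 'I_2 => if val i == 0 then d else d')) => v /=.
exists [tuple g v; h v]; split; last exact: He [tuple g v; h v].
by move=> i; rewrite (tnth_nth 0); case: i => [[|[|i]] Hi].
Qed.

Lemma computable_succ n f : comp n f -> comp n (fun v => (f v).+1).
Proof.
apply: computable_comp1; exists Succ => v /=.
by case/tupleP: v => x v; rewrite theadE.
Qed.

Lemma computable_oracle n f : comp n f -> comp n (fun v => A (f v)).
Proof.
apply: (@computable_comp1 n (fun x => A x)); exists Oracle => v /=.
by case/tupleP: v => x v; rewrite theadE.
Qed.

Lemma computable_const n c : comp n (fun=> c).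
Proof.
elim: c => [|c IH]; first by exists (Zero n).
exact: computable_succ.
Qed.

Lemma computable_weaken n f : comp n f -> comp n.+1 (fun v => f (behead v)).
Proof.
move=> [e He]; exists (Comp e (fun i => Proj (lift ord0 i))) => v /=.
case/tupleP: v => x v; exists v; split=> [i|/=]; last exact: He.
by rewrite tnthS.
Qed.

Lemma computable_nth_behead n i :
  i < n -> comp n.+1 (fun v => nth 0 (behead v) i).
Proof. by move=> H; apply/(@computable_weaken n (fun v => nth 0 v i))/computable_nth. Qed.

Lemma computable_nth_behead2 n i :
  i < n -> comp n.+2 (fun v => nth 0 (behead (behead v)) i).
Proof.
by move=> H; apply/(@computable_weaken _ (fun v => nth 0 (behead v) i))/computable_nth_behead.
Qed.

Lemma computable_rec n (k f : seq nat -> nat) (g : nat -> nat -> seq nat -> nat) :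
  comp n k -> comp n f ->
  comp n.+2 (fun v => g (nth 0 v 0) (nth 0 v 1) (behead (behead v))) ->
  comp n (fun v => nat_rect (fun=> nat) (f v) (fun i z => g i z v) (k v)).
Proof.
move=> [ek Hk] [ef Hf] [eg Hg].
exists (Comp (PrimRec ef eg)
  (fun i => if unlift ord0 i is Some j then Proj j else ek)) => v /=.
exists [tuple of k v :: v]; split.
  move=> i; case: unliftP => [j ->|->] /=; first by rewrite tnthS.
  by rewrite tnth0.
rewrite theadE; lazymatch goal with |- ?loop _ _ =>
  suff: forall m, loop m (nat_rect (fun=> nat) (f v) (fun i z => g i z v) m) by exact
end.
elim=> [|m IH] /=.
  by set ps := [tuple of _]; have -> : ps = v by apply: val_inj.
set z := nat_rect _ _ _ m; exists z; split; first exact: IH.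
set w := [tuple of _]; have -> : w = [tuple of m :: z :: v] by apply: val_inj.
exact: Hg [tuple of m :: z :: v].
Qed.

Lemma computable_mu n (t : nat -> seq nat -> nat) (m : seq nat -> nat) :
  comp n.+1 (fun v => t (nth 0 v 0) (behead v)) ->
  (forall v : n.-tuple nat, t (m v) v = 0 /\ forall i, i < m v -> 0 < t i v) ->
  comp n m.
Proof.
move=> [e He] H; exists (Mu e) => v /=; have [H0 Hi] := H v; split.
  by rewrite -[X in recf_eval _ _ _ X]H0; apply: He [tuple of m v :: v].
move=> i /Hi lt; exists (t i v).-1; rewrite prednK //.
Qed.

Lemma computable_add n f g : comp n f -> comp n g -> comp n (fun v => f v + g v).
Proof.
apply: computable_comp2.
apply: (@computable_ext _ (fun v => nat_rect (fun=> nat) (nth 0 v 1)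
  (fun _ z => z.+1) (nth 0 v 0))).
  by move=> v; elim: (nth 0 v 0) => //= k ->.
apply: (@computable_rec _ _ _ (fun _ z _ => z.+1)); try exact: computable_nth.
by apply/computable_succ/computable_nth.
Qed.

Lemma computable_mul n f g : comp n f -> comp n g -> comp n (fun v => f v * g v).
Proof.
apply: computable_comp2.
apply: (@computable_ext _ (fun v => nat_rect (fun=> nat) 0
  (fun _ z => nth 0 v 1 + z) (nth 0 v 0))).
  by move=> v; elim: (nth 0 v 0) => //= k ->; rewrite mulSn.
apply: (@computable_rec _ _ _ (fun _ z v => nth 0 v 1 + z)).
- exact: computable_nth.
- exact: computable_const.
- apply: computable_add; last exact: computable_nth.
  exact: computable_nth_behead2.
Qed.

Lemma computable_expn n b f : comp n f -> comp n (fun v => b ^ f v).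
Proof.
apply: computable_comp1.
apply: (@computable_ext _ (fun v => nat_rect (fun=> nat) 1
  (fun _ z => b * z) (nth 0 v 0))).
  by move=> v; elim: (nth 0 v 0) => //= k ->; rewrite expnS.
apply: (@computable_rec _ _ _ (fun _ z v => b * z)).
- exact: computable_nth.
- exact: computable_const.
- by apply: computable_mul; [apply: computable_const|apply: computable_nth].
Qed.

Lemma computable_pred n f : comp n f -> comp n (fun v => (f v).-1).
Proof.
apply: computable_comp1.
apply: (@computable_ext _ (fun v => nat_rect (fun=> nat) 0
  (fun i _ => i) (nth 0 v 0))); first by move=> v; case: (nth 0 v 0).
apply: (@computable_rec _ _ _ (fun i _ v => i)).
- exact: computable_nth.
- exact: computable_const.
- exact: computable_nth.
Qed.

Lemma computable_sub n f g : comp n f -> comp n g -> comp n (fun v => f v - g v).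
Proof.
apply: computable_comp2.
apply: (@computable_ext _ (fun v => nat_rect (fun=> nat) (nth 0 v 0)
  (fun _ z => z.-1) (nth 0 v 1))).
  move=> v; elim: (nth 0 v 1) => /= [|k ->]; first by rewrite subn0.
  by rewrite subnS.
apply: (@computable_rec _ _ _ (fun _ z v => z.-1)); try exact: computable_nth.
by apply/computable_pred/computable_nth.
Qed.

Lemma computable_odd n f : comp n f -> comp n (fun v => odd (f v)).
Proof.
apply: (@computable_comp1 n (fun x => odd x)).
apply: (@computable_ext _ (fun v => nat_rect (fun=> nat) 0
  (fun _ z => 1 - z) (nth 0 v 0))).
  by move=> v; elim: (nth 0 v 0) => //= k ->; case: odd.
apply: (@computable_rec _ _ _ (fun _ z v => 1 - z)).
- exact: computable_nth.
- exact: computable_const.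
- by apply: computable_sub; [apply: computable_const|apply: computable_nth].
Qed.

Lemma computable_eqn n f g :
  comp n f -> comp n g -> comp n (fun v => f v == g v).
Proof.
move=> Hf Hg.
apply: (@computable_ext _ (fun v => 1 - ((f v - g v) + (g v - f v)))).
  by move=> v; lia.
by apply: computable_sub; [apply: computable_const|apply: computable_add; apply: computable_sub].
Qed.

Lemma computable_divSn n f g :
  comp n f -> comp n g -> comp n (fun v => f v %/ (g v).+1).
Proof.
apply: (@computable_comp2 n (fun x d => x %/ d.+1)).
apply: (@computable_mu _ (fun z v => (nth 0 v 0).+1 - (nth 0 v 1).+1 * z.+1)).
  apply: computable_sub; [apply: computable_succ|apply: computable_mul; apply: computable_succ].
  - exact: computable_nth_behead.
  - exact: computable_nth_behead.
  - exact: computable_nth.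
move=> v; set x := nth 0 v 0; set d := nth 0 v 1; split.
  by apply/eqP; rewrite subn_eq0 mulnC ltn_ceil.
move=> i Hi; rewrite subn_gt0 ltnS; apply: leq_trans (leq_trunc_div x d.+1).
by rewrite mulnC leq_mul2r Hi orbT.
Qed.

End Computable.

(* [rinv g x] is the index of the interval [g z, g z.+1) containing x, for g
   increasing; it is 0 if x < g 0. *)
Definition rinv (g : nat -> nat) (x : nat) : nat :=
  find (fun z => x < g z.+1) (iota 0 x.+1).

Section RightInverse.
Variable g : nat -> nat.
Hypothesis g_mono : {homo g : x y / x < y}.

Lemma homo_ltn_geq z : z <= g z.
Proof. by elim: z => // z IH; apply: leq_ltn_trans IH (g_mono (ltnSn z)). Qed.

Lemma rinvP x : x < g (rinv g x).+1 /\ forall i, i < rinv g x -> g i.+1 <= x.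
Proof.
have hasx : has (fun z => x < g z.+1) (iota 0 x.+1).
  apply/hasP; exists x; first by rewrite mem_iota add0n ltnSn.
  exact: homo_ltn_geq.
have := hasx; rewrite has_find size_iota -/(rinv g x) => lt; split.
  by have := nth_find 0 hasx; rewrite -/(rinv g x) nth_iota.
move=> i Hi; have := before_find 0 Hi; rewrite nth_iota ?(ltn_trans Hi) //.
by rewrite add0n => /negbT; rewrite -leqNgt.
Qed.

Lemma rinv_ge x : g 0 <= x -> g (rinv g x) <= x.
Proof. by case: (rinvP x) => _; case: (rinv g x) => // k H _; apply: H. Qed.

Lemma rinv_eq x z : g z <= x < g z.+1 -> rinv g x = z.
Proof.
move=> /andP[H1 H2]; have [H3 H4] := rinvP x.
have mono := leq_mono g_mono.
case: (ltngtP (rinv g x) z) => // lt.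
- have le : g (rinv g x).+1 <= g z by rewrite mono.
  by have := leq_trans H3 (leq_trans le H1); rewrite ltnn.
- by have := H4 _ lt; rewrite leqNgt H2.
Qed.

Lemma computable_rinv A n f :
  computable A 1 (fun v => g (nth 0 v 0)) -> computable A n f ->
  computable A n (fun v => rinv g (f v)).
Proof.
move=> Hg; apply: computable_comp1.
apply: (@computable_mu _ _ (fun z v => (nth 0 v 0).+1 - g z.+1)).
  apply: computable_sub.
    by apply/computable_succ/computable_nth_behead.
  by apply/(computable_comp1 Hg)/computable_succ/computable_nth.
move=> v; have [H1 H2] := rinvP (nth 0 v 0); split.
  by apply/eqP; rewrite subn_eq0.
by move=> i /H2; rewrite subn_gt0 ltnS.
Qed.

End RightInverse.

(** * Codes of strings *)

Lemma strcode_inj : injective strcode.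
Proof.
elim=> [|b s IH] [|c t] //= [] E.
have [Eb Es] : b = c /\ strcode s = strcode t.
  by move: b c E => [] [] /=; lia.
by rewrite Eb (IH _ Es).
Qed.

Lemma strcode_bounds s : 2 ^ size s <= (strcode s).+1 < 2 ^ (size s).+1.
Proof.
elim: s => //= b s; rewrite !expnS; move: (2 ^ size s) => k.
by case: b; lia.
Qed.

Lemma strcode_cat_zeros s m :
  strcode (s ++ nseq m false) + 2 ^ size s = strcode s + 2 ^ (size s + m).
Proof.
elim: s => /= [|b s]; last first.
  by rewrite addSn !expnS; move: (2 ^ size s) (2 ^ (size s + m)) => k l; case: b; lia.
elim: m => //= m; rewrite !add0n expnS; move: (2 ^ m) => k; lia.
Qed.

Lemma strcode_cat_ones x s :
  strcode (nseq x true ++ s) + 2 = 2 ^ x * (strcode s + 2).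
Proof.
elim: x => /= [|x]; first by rewrite expn0 mul1n.
by rewrite expnS -mulnA => <-; lia.
Qed.

Definition unary_pair (x y : nat) : seq bool :=
  nseq x true ++ false :: nseq y true ++ [:: false].

Lemma size_unary_pair x y : size (unary_pair x y) = x + y + 2.
Proof. by rewrite size_cat /= size_cat !size_nseq /=; lia. Qed.

Lemma strcode_unary_pair x y :
  strcode (unary_pair x y) = 2 ^ x * (6 * 2 ^ y - 1) - 2.
Proof.
have := strcode_cat_ones x (false :: nseq y true ++ [:: false]).
rewrite -/(unary_pair x y) /=; have := strcode_cat_ones y [:: false] => /=.
have : 0 < 2 ^ y by rewrite expn_gt0.
move: (2 ^ x) (2 ^ y) (strcode (nseq _ _ ++ _)) => k l c l0 Ec Eu.
have -> : 6 * l - 1 = (false + c.*2).+1 + 2 by lia.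
by rewrite -Eu; lia.
Qed.

Lemma cat_ones_inj x x' s s' :
  nseq x true ++ false :: s = nseq x' true ++ false :: s' -> x = x' /\ s = s'.
Proof.
elim: x x' => [|x IH] [|x'] //= []; first by move=> ->.
by move=> /IH [-> ->].
Qed.

Lemma prefix_unary_pair x y x' y' :
  prefix (unary_pair x y) (unary_pair x' y') -> x = x' /\ y = y'.
Proof.
move=> /prefixP [r]; rewrite /unary_pair -catA cat_cons -catA => /esym.
by move=> /cat_ones_inj [-> /cat_ones_inj [-> _]].
Qed.

(** * Programs of an optimal machine *)

Lemma prefix_free_machine_of_family (P : nat -> seq bool) (h : nat -> nat) :
  computable (fun=> false) 1 (fun v => strcode (P (nth 0 v 0))) ->
  computable (fun=> false) 1 (fun v => h (nth 0 v 0)) ->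
  (forall i j, prefix (P i) (P j) -> i = j) ->
  exists M, prefix_free_machine M /\
    forall w s, strcode s = h w -> M (P w) s.
Proof.
move=> HP [eh Hh] Pinj.
have [et Ht] : computable (fun=> false) 2 (fun v =>
    (strcode (P (nth 0 v 0)) - nth 0 v 1) + (nth 0 v 1 - strcode (P (nth 0 v 0)))).
  have HP2 : computable (fun=> false) 2 (fun v => strcode (P (nth 0 v 0))).
    by apply: (@computable_comp1 _ _ (fun x => strcode (P x)) _ HP); apply: computable_nth.
  by apply: computable_add; apply: computable_sub => //; apply: computable_nth.
pose e := Comp eh (fun=> Mu et).
have evalP p y : recf_eval (fun=> false) e [tuple strcode p] y ->
    exists w, p = P w.
  move=> [w [Hw _]]; have [/= H0 _] := Hw ord0; exists (tnth w ord0).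
  have E := recf_eval_functional H0 (Ht [tuple tnth w ord0; strcode p]).
  by apply: strcode_inj; move: E => /=; lia.
exists (fun p s => recf_eval (fun=> false) e [tuple strcode p] (strcode s)).
split; first split.
- by exists e.
- by move=> p q s t /evalP [i ->] /evalP [j ->] /Pinj ->.
- move=> w s E; exists [tuple w]; split; last by rewrite E; apply: Hh [tuple w].
  move=> i; rewrite ord1 tnth0 /=; split.
    by have := Ht [tuple w; strcode (P w)]; rewrite /= subnn.
  move=> j ltjw; exists ((strcode (P j) - strcode (P w)) + (strcode (P w) - strcode (P j))).-1.
  rewrite prednK; first exact: Ht [tuple j; strcode (P w)].
  rewrite lt0n; apply: contraTneq ltjw => E0.
  have /strcode_inj Ejw : strcode (P j) = strcode (P w) by lia.
  by rewrite (Pinj j w) ?ltnn // Ejw prefix_refl.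
Qed.

Section Sqrt.
Let sq n := n * n.
Let sq_mono : {homo sq : x y / x < y}.
Proof. by move=> x y lt; rewrite /sq; nia. Qed.

Definition nsqrt := rinv sq.

Lemma nsqrt_eq x y : x <= y.*2 -> nsqrt (y * y + x) = y.
Proof. by move=> le; apply: rinv_eq => //; rewrite /sq; nia. Qed.

Lemma nsqrt_le w : nsqrt w * nsqrt w <= w.
Proof. exact: (rinv_ge sq_mono). Qed.

Lemma computable_nsqrt A n f :
  computable A n f -> computable A n (fun v => nsqrt (f v)).
Proof.
by apply: computable_rinv => //; apply: computable_mul; apply: computable_nth.
Qed.
End Sqrt.

Definition nsqrt_rem w := w - nsqrt w * nsqrt w.

Lemma computable_nsqrt_rem A n f :
  computable A n f -> computable A n (fun v => nsqrt_rem (f v)).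
Proof.
by move=> Hf; apply: computable_sub => //; apply: computable_mul; apply: computable_nsqrt.
Qed.

(* The string rho of value a < 2 ^ size rho is described by the number n of
   bits of the padded string and by a, via x = 4 a + n %% 4, n = 4 y + x. *)
Lemma padded_string_program U : optimal_prefix_free_machine U ->
  exists c, forall rho n, 2 ^ (size rho + 8) <= n ->
    exists q, U q (rho ++ nseq (n - size rho) false) /\ 16 * size q <= 5 * n + c.
Proof.
move=> [_ HU].
pose P w := unary_pair (nsqrt_rem w) (nsqrt w).
pose h w := 2 ^ (4 * nsqrt w + nsqrt_rem w) + nsqrt_rem w %/ 4 - 1.
have cv : computable (fun=> false) 1 (fun v => nth 0 v 0) by apply: computable_nth.
have cr := computable_nsqrt_rem cv; have cs := computable_nsqrt cv.
have [M [HM Mw]] : exists M, prefix_free_machine M /\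
    forall w s, strcode s = h w -> M (P w) s.
  apply: prefix_free_machine_of_family.
  - apply: (@computable_ext _ _ (fun v => 2 ^ nsqrt_rem (nth 0 v 0) *
      (6 * 2 ^ nsqrt (nth 0 v 0) - 1) - 2)).
      by move=> v; rewrite strcode_unary_pair.
    apply: computable_sub; last exact: computable_const.
    apply: computable_mul; first exact: computable_expn.
    apply: computable_sub; last exact: computable_const.
    by apply: computable_mul; [exact: computable_const|exact: computable_expn].
  - apply: computable_sub; last exact: computable_const.
    apply: computable_add; last first.
      by apply: computable_divSn => //; apply: computable_const.
    apply/computable_expn/computable_add => //.
    by apply: computable_mul => //; apply: computable_const.
  - move=> i j /prefix_unary_pair [Er Es].
    have := nsqrt_le i; have := nsqrt_le j; move: Er; rewrite /nsqrt_rem Es; lia.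
have [c Hc] := HU _ HM; exists (16 * (c + 5)) => rho n.
rewrite expnD => le.
set a := (strcode rho).+1 - 2 ^ size rho.
have := strcode_bounds rho; rewrite expnS => bd.
have ltn : size rho < 2 ^ size rho by apply: ltn_expl.
have E8 : 2 ^ 8 = 256 by [].
pose x := 4 * a + n %% 4; pose y := n %/ 4 - a.
have r4 : n %% 4 < 4 by rewrite ltn_mod.
have nE := divn_eq n 4.
have lea : a * 256 <= n by rewrite /a; nia.
have n0 : 256 <= n by nia.
have lexy : x <= y.*2 by rewrite /x /y; lia.
have yE : nsqrt (y * y + x) = y by apply: nsqrt_eq.
have xE : nsqrt_rem (y * y + x) = x by rewrite /nsqrt_rem yE; lia.
have [|q [Uq szq]] := Hc (P (y * y + x)) (rho ++ nseq (n - size rho) false).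
  apply: Mw; rewrite /h yE xE.
  have -> : x %/ 4 = a by rewrite /x; lia.
  have -> : 4 * y + x = n by rewrite /x /y; lia.
  have := strcode_cat_zeros rho (n - size rho).
  have -> : size rho + (n - size rho) = n by nia.
  by rewrite /a; lia.
exists q; split=> //; move: szq; rewrite size_unary_pair yE xE /x /y; lia.
Qed.

Lemma optimal_machine_functional U : optimal_prefix_free_machine U ->
  forall p s t, U p s -> U p t -> s = t.
Proof.
move=> [[[e He] _] _] p s t /He Hs /He Ht.
by apply: strcode_inj; apply: recf_eval_functional Hs Ht.
Qed.

Lemma incompressible_extension (U : seq bool -> seq bool -> Prop) :
  (forall p s t, U p s -> U p t -> s = t) ->
  forall s m, exists t, size t = m /\ forall p, U p (s ++ t) -> m <= size p.
Proof.
move=> Ufun s m; apply: contrapT => H.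
have Hp (t : m.-tuple bool) : exists p, U p (s ++ t) /\ size p < m.
  apply: contrapT => Ht; apply: H; exists t; split; first exact: size_tuple.
  move=> p Hp; rewrite leqNgt; apply/negP => lt; apply: Ht; by exists p.
have [f Hf] := choice Hp.
have ltf t : strcode (f t) < (2 ^ m).-1.
  have [_ lt] := Hf t; have /andP[_ lt2] := strcode_bounds (f t).
  have : 2 ^ (size (f t)).+1 <= 2 ^ m by rewrite leq_exp2l.
  by move: lt2; lia.
have inj : injective (fun t => Ordinal (ltf t)).
  move=> t u [] /strcode_inj E; have [Ut _] := Hf t; have [Uu _] := Hf u.
  move: Uu; rewrite -E => /(Ufun _ _ _ Ut) /eqP.
  by rewrite eqseq_cat // eqxx => /= /eqP /val_inj.
have := leq_card _ inj; rewrite card_ord card_tuple card_bool.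
have : 0 < 2 ^ m by rewrite expn_gt0.
lia.
Qed.

(** * Blocks and codes of the initial segments of A *)

(* The block of index k is [block_start k, block_start k.+1). *)
Fixpoint block_start k :=
  if k is k'.+1 then 2 ^ (2 * block_start k' + 8) else 1.

Lemma block_start_double k : 2 * block_start k < block_start k.+1.
Proof.
have := @ltn_expl 2 (2 * block_start k) isT.
by rewrite [block_start k.+1]/= expnD; lia.
Qed.

Lemma block_start_mono : {homo block_start : x y / x < y}.
Proof.
apply: homo_ltn => [? ? ?|k]; first exact: ltn_trans.
by have := block_start_double k; lia.
Qed.

Lemma block_start_gt0 k : 0 < block_start k.
Proof. by case: k => //= k; rewrite expn_gt0. Qed.

Lemma computable_block_start A n f :
  computable A n f -> computable A n (fun v => block_start (f v)).
Proof.
apply: computable_comp1.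
apply: (@computable_ext _ _ (fun v => nat_rect (fun=> nat) 1
  (fun _ z => 2 ^ (2 * z + 8)) (nth 0 v 0))).
  by move=> v; elim: (nth 0 v 0) => //= k ->.
apply: (@computable_rec _ _ _ _ (fun _ z _ => 2 ^ (2 * z + 8))).
- exact: computable_nth.
- exact: computable_const.
- apply/computable_expn/computable_add; last exact: computable_const.
  by apply: computable_mul; [apply: computable_const|apply: computable_nth].
Qed.

Definition block_of := rinv block_start.

Lemma block_ofP n : 0 < n ->
  block_start (block_of n) <= n < block_start (block_of n).+1.
Proof.
move=> n0; rewrite (rinv_ge block_start_mono) //.
by have [] := rinvP block_start_mono n.
Qed.

Lemma leq_block_of k n : block_start k <= n -> k <= block_of n.
Proof.
move=> le; have [lt _] := rinvP block_start_mono n.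
by rewrite -ltnS -(leqW_mono (leq_mono block_start_mono)) (leq_ltn_trans le).
Qed.

Lemma computable_block_of A n f :
  computable A n f -> computable A n (fun v => block_of (f v)).
Proof.
apply: computable_rinv; first exact: block_start_mono.
exact/computable_block_start/computable_nth.
Qed.

Section InitialSegments.
Variable A : nat -> bool.

Fixpoint low_bits l := if l is l'.+1 then low_bits l' + A l' * 2 ^ l' else 0.

Definition segment_code l := 2 ^ l + low_bits l.

Lemma low_bits_lt l : low_bits l < 2 ^ l.
Proof. by elim: l => //= l; rewrite expnS; case: (A l); lia. Qed.

Lemma segment_code_lt l : segment_code l < 2 ^ l.+1.
Proof. by have := low_bits_lt l; rewrite /segment_code expnS; lia. Qed.

Lemma segment_code_mono : {homo segment_code : x y / x < y}.
Proof.
apply: homo_ltn => [? ? ?|l]; first exact: ltn_trans.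
by apply: leq_trans (segment_code_lt l) _; apply: leq_addr.
Qed.

Lemma segment_code_bit m l : m < l -> odd (segment_code l %/ 2 ^ m) = A m.
Proof.
move=> lt; have [z ->] : exists z,
    segment_code l = (2 * z + A m) * 2 ^ m + low_bits m.
  rewrite -(subnKC lt); elim: (l - m.+1) => [|d [z IH]].
    by exists 1; rewrite addn0 /segment_code /= expnS; lia.
  exists (z + (1 + A (m.+1 + d)) * 2 ^ d).
  have E : 2 ^ (m.+1 + d) = 2 * 2 ^ m * 2 ^ d by rewrite expnD expnS.
  move: IH E; rewrite addnS /segment_code; move: (m.+1 + d) => k.
  have -> : low_bits k.+1 = low_bits k + A k * 2 ^ k by [].
  by rewrite expnS; move: (2 ^ k) (2 ^ m) (2 ^ d) => x y t; case: (A k); nia.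
rewrite divnMDl ?expn_gt0 // divn_small ?low_bits_lt // addn0.
by rewrite oddD oddM /= oddb.
Qed.

Lemma computable_segment_code n f :
  computable A n f -> computable A n (fun v => segment_code (f v)).
Proof.
move=> Hf; apply: computable_add; first exact: computable_expn.
apply: computable_comp1 Hf.
apply: (@computable_ext _ _ (fun v => nat_rect (fun=> nat) 0
  (fun i z => z + A i * 2 ^ i) (nth 0 v 0))).
  by move=> v; elim: (nth 0 v 0) => //= k ->.
apply: (@computable_rec _ _ _ _ (fun i z _ => z + A i * 2 ^ i)).
- exact: computable_nth.
- exact: computable_const.
- apply: computable_add; first exact: computable_nth.
  apply: computable_mul; first exact/computable_oracle/computable_nth.
  exact/computable_expn/computable_nth.
Qed.

Definition code_point l := 2 * block_start (segment_code l).

Lemma code_point_mono : {homo code_point : x y / x < y}.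
Proof.
by move=> x y /segment_code_mono/block_start_mono; rewrite /code_point; lia.
Qed.

Definition code_points n := n == code_point (rinv code_point n).

Lemma code_pointsP n : reflect (exists l, n = code_point l) (code_points n).
Proof.
apply: (iffP eqP) => [->|[l ->]]; first by eexists.
rewrite (rinv_eq code_point_mono (z := l)) // leqnn /=.
exact: code_point_mono.
Qed.

Lemma turing_le_code_points : turing_le code_points A.
Proof.
have cc n f : computable A n f -> computable A n (fun v => code_point (f v)).
  move=> Hf; apply: computable_mul; first exact: computable_const.
  exact/computable_block_start/computable_segment_code.
have [e He] : computable A 1 (fun v => code_points (nth 0 v 0)).
  apply: computable_eqn; first exact: computable_nth.
  apply/cc/computable_rinv; first exact: code_point_mono.
  - exact/cc/computable_nth.
  - exact: computable_nth.
by exists e => n; apply: He [tuple n].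
Qed.

End InitialSegments.

Lemma infinite_set_natP (N : nat -> bool) :
  infinite_set [set n | N n]%classic <-> forall m, exists n, m <= n /\ N n.
Proof.
split=> [Ninf m|H].
  apply: contrapT => Hm; apply: Ninf; apply: sub_finite_set (finite_II m).
  move=> n /= Nn; rewrite ltnNge; apply/negP => le; apply: Hm; by exists n.
move=> /finite_seqP [s Es].
have [n [len Nn]] := H (\max_(i <- s) i).+1.
have : [set` s]%classic n by rewrite -Es.
by move=> /= ns; move: len; rewrite ltnNge (leq_bigmax_seq _ ns).
Qed.

(* Every element of N beyond n0 lies in a block that encodes an initial segment
   of A, so N computes A by reading off a bit of the index of a late block. *)
Lemma turing_le_of_coding_blocks (A B N : nat -> bool) n0 :
  infinite_set [set n | N n]%classic -> turing_le N B ->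
  (forall n, n0 <= n -> N n -> exists l, block_of n = segment_code A l) ->
  turing_le A B.
Proof.
move=> /infinite_set_natP Ninf [eN HN] Ncode.
pose thr m := n0 + block_start (2 ^ m.+1).
have exN m : exists n, (thr m <= n) && N n.
  by have [n [le Nn]] := Ninf (thr m); exists n; rewrite le.
pose s m := ex_minn (exN m).
have cN n f : computable B n f -> computable B n (fun v => N (f v)).
  apply: (@computable_comp1 _ _ (fun x => N x)); exists eN => v.
  by case/tupleP: v => x v; have -> : [tuple of x :: v] = [tuple x]
    by apply: val_inj; rewrite /= (tuple0 v).
have cs : computable B 1 (fun v => s (nth 0 v 0)).
  apply: (@computable_mu _ _ (fun z v => (1 - N z) + (thr (nth 0 v 0) - z))).
    apply: computable_add; apply: computable_sub.
    - exact: computable_const.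
    - exact/cN/computable_nth.
    - apply: computable_add; first exact: computable_const.
      exact/computable_block_start/computable_expn/computable_succ/computable_nth_behead.
    - exact: computable_nth.
  move=> v; rewrite /s; case: ex_minnP => z /andP[le Nz] min; split.
    by rewrite Nz; lia.
  move=> i lt; rewrite lt0n; apply/eqP => E0.
  have : z <= i by apply: min; move: E0; case: (N i); lia.
  by lia.
have [e He] : computable B 1 (fun v => A (nth 0 v 0)).
  apply: (@computable_ext _ _ (fun v =>
      odd (block_of (s (nth 0 v 0)) %/ (2 ^ nth 0 v 0).-1.+1))); last first.
    apply/computable_odd/computable_divSn; first exact: computable_block_of.
    exact/computable_pred/computable_expn/computable_nth.
  move=> v; move: (nth 0 v 0) => m; rewrite prednK ?expn_gt0 // /s.
  case: ex_minnP => n /andP[le Nn] _.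
  have [|l El] := Ncode n _ Nn; first by move: le; rewrite /thr; lia.
  rewrite El segment_code_bit //.
  have : 2 ^ m.+1 <= block_of n by apply: leq_block_of; move: le; rewrite /thr; lia.
  rewrite El => /leq_ltn_trans /(_ (segment_code_lt A l)).
  by rewrite ltn_exp2l // ltnS.
by exists e => n; apply: He [tuple n].
Qed.

(** * The separating sequence *)

Lemma mkseq_nth_prefix (X : nat -> bool) s n :
  (forall i, i < size s -> X i = nth false s i) -> n <= size s ->
  mkseq X n = take n s.
Proof.
move=> HX le; apply: (@eq_from_nth _ false).
  by rewrite size_mkseq size_takel.
move=> i; rewrite size_mkseq => lt; rewrite nth_mkseq // nth_take //.
exact/HX/(leq_trans lt).
Qed.

Lemma incompressible_block_sequence (U : seq bool -> seq bool -> Prop)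
    (S : nat -> Prop) : (forall p s t, U p s -> U p t -> s = t) ->
  exists X : nat -> bool,
    (forall k, S k -> forall p, U p (mkseq X (2 * block_start k)) ->
      block_start k <= size p) /\
    (forall k n, ~ S k.+1 -> block_start k.+1 <= n < block_start k.+2 ->
      exists rho, size rho = 2 * block_start k /\
        mkseq X n = rho ++ nseq (n - size rho) false).
Proof.
move=> Ufun.
have /choice [ext Hext] (s : seq bool) : exists t, size t = size s /\
    forall p, U p (s ++ t) -> size s <= size p.
  exact: incompressible_extension.
pose half (k : nat) s : seq bool :=
  s ++ (if `[< S k >] then ext s else nseq (size s) false).
have [L [L0 LE]] : exists L : nat -> seq bool, L 0 = [:: false] /\
    forall k, L k.+1 =
      half k (L k) ++ nseq (block_start k.+1 - 2 * block_start k) false.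
  by exists (fix L k := if k is k'.+1 then half k' (L k') ++
    nseq (block_start k - 2 * block_start k') false else [:: false]).
have szhalf k s : size (half k s) = 2 * size s.
  rewrite size_cat; case: ifP => _; last by rewrite size_nseq; lia.
  by rewrite (Hext s).1; lia.
have szL k : size (L k) = block_start k.
  elim: k => [|k IH]; first by rewrite L0.
  rewrite LE size_cat szhalf size_nseq IH.
  by have := block_start_double k; lia.
have LS k d : prefix (L k) (L (k + d)).
  elim: d => [|d IH]; first by rewrite addn0 prefix_refl.
  rewrite addnS; apply: prefix_trans IH _.
  by rewrite LE /half -catA prefix_prefix.
have ltnL n : n < size (L n.+1) by rewrite szL; apply: homo_ltn_geq block_start_mono _.
pose X n := nth false (L n.+1) n.
have LX k i : i < size (L k) -> X i = nth false (L k) i.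
  move=> lt; rewrite /X; case: (leqP i.+1 k) => [le|/ltnW le].
    have /prefixP [r Er] := LS i.+1 (k - i.+1).
    by move: Er; rewrite subnKC // => ->; rewrite nth_cat ltnL.
  have /prefixP [r Er] := LS k (i.+1 - k).
  by move: Er; rewrite subnKC // => ->; rewrite nth_cat lt.
have mkX k n : n <= block_start k -> mkseq X n = take n (L k).
  by move=> le; apply: mkseq_nth_prefix; rewrite ?szL // => i; rewrite -szL; apply: LX.
exists X; split.
- move=> k Sk p; rewrite (mkX k.+1); last exact/ltnW/block_start_double.
  rewrite LE take_size_cat ?szhalf ?szL // /half.
  case: asboolP => // _; rewrite -szL; exact: (Hext (L k)).2.
- move=> k n NS /andP[le lt]; exists (half k (L k)).
  rewrite szhalf szL; split=> //.
  have dbl := block_start_double k.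
  pose r m := half k (L k) ++ nseq m false.
  have Lr : L k.+2 = r (block_start k.+2 - 2 * block_start k).
    rewrite LE {1}/half; case: asboolP => // _; rewrite szL LE /r -!catA.
    rewrite -!nseqD; congr (_ ++ (_ ++ nseq _ _)).
    by have := block_start_double k.+1; lia.
  rewrite (mkX k.+2) ?(ltnW lt) // Lr /r take_cat szhalf szL.
  have -> : n < 2 * block_start k = false by lia.
  by rewrite take_nseq //; lia.
Qed.

Section ComplexityRatio.
Variables (R : realType) (U : seq bool -> seq bool -> Prop).

Lemma prefixK_ratio_le s p n a b : U p s -> 0 < n -> 0 < b ->
  size p * b <= n * a ->
  (prefixK R U s * ((n%:R : R)^-1)%R%:E <= (a%:R / b%:R : R)%:E)%E.
Proof.
move=> Up n0 b0 le.
have nR : (0 < n%:R :> R)%R by rewrite ltr0n.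
have bR : (0 < b%:R :> R)%R by rewrite ltr0n.
have leK : (prefixK R U s <= ((size p)%:R : R)%:E)%E.
  by apply: ereal_inf_lbound; exists p.
apply: le_trans (lee_wpmul2r _ leK) _; first by rewrite lee_fin invr_ge0 ltW.
rewrite -EFinM lee_fin ler_pdivrMr // mulrAC ler_pdivlMr //.
by rewrite -!natrM ler_nat [a * n]mulnC.
Qed.

Lemma prefixK_ratio_ge s m n a b : 0 < n -> 0 < b -> n * a <= m * b ->
  (forall p, U p s -> m <= size p) ->
  ((a%:R / b%:R : R)%:E <= prefixK R U s * ((n%:R : R)^-1)%R%:E)%E.
Proof.
move=> n0 b0 le Hp.
have nR : (0 < n%:R :> R)%R by rewrite ltr0n.
have bR : (0 < b%:R :> R)%R by rewrite ltr0n.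
have leK : ((m%:R : R)%:E <= prefixK R U s)%E.
  by apply: le_ereal_inf_tmp => _ [p Up <-]; rewrite lee_fin ler_nat; apply: Hp.
apply: le_trans (lee_wpmul2r _ leK); last by rewrite lee_fin invr_ge0 ltW.
rewrite -EFinM lee_fin ler_pdivrMr // mulrAC ler_pdivlMr //.
by rewrite -!natrM ler_nat mulnC.
Qed.

End ComplexityRatio.

Lemma dim_si_mono (R : realType) U (A B X : nat -> bool) :
  turing_le A B -> (dim_si R U A X <= dim_si R U B X)%E.
Proof.
move=> AB; apply: ge_ereal_sup => _ [N [Ninf NA] <-].
apply: ereal_sup_ubound; exists N => //; split=> //.
exact: turing_le_trans NA AB.
Qed.

Lemma dim_si_separation (R : realType) U (A B : nat -> bool) :
  optimal_prefix_free_machine U -> ~ turing_le A B ->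
  exists X, (dim_si R U B X <= (3%:R / 8%:R : R)%:E)%E /\
            ((1%:R / 2%:R : R)%:E <= dim_si R U A X)%E.
Proof.
move=> hU nAB; have Ufun := optimal_machine_functional hU.
have [X [Xge Xpad]] := incompressible_block_sequence
  (fun k => exists l, k = segment_code A l) Ufun.
have [c Hc] := padded_string_program hU.
exists X; split.
- apply: ge_ereal_sup => _ [N [Ninf NB] <-].
  have [n [len Nn nocode]] : exists n,
      [/\ block_start 1 + c <= n, N n & forall l, block_of n <> segment_code A l].
    apply: contrapT => H; apply: nAB.
    apply: (turing_le_of_coding_blocks (n0 := block_start 1 + c) Ninf NB).
    move=> n len Nn; apply: contrapT => Hn; apply: H; exists n; split=> // l El.
    by apply: Hn; exists l.
  have n0 : 0 < n by have := block_start_gt0 1; lia.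
  have := block_ofP n0; have : 1 <= block_of n by apply: leq_block_of; lia.
  case Ek : (block_of n) => [//|k] _ bd.
  have [|rho [szrho En]] := Xpad k n _ bd.
    by move=> [l El]; apply: (nocode l); rewrite Ek.
  have [|q [Uq szq]] := Hc rho n.
    by rewrite szrho; case/andP: bd.
  apply: le_trans (prefixK_ratio_le R (n := n) (a := 3) (b := 8) Uq n0 isT _); last by lia.
  by apply: ereal_inf_lbound; exists n => //; rewrite En.
- apply: le_trans (ereal_sup_ubound _); last first.
    exists (code_points A); last by [].
    split; last exact: turing_le_code_points.
    apply/infinite_set_natP => m; exists (code_point A m).
    split; first exact: homo_ltn_geq (@code_point_mono A) m.
    by apply/code_pointsP; exists m.
  apply: le_ereal_inf_tmp => _ [_ [/code_pointsP [l ->] n0] <-].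
  apply: (@prefixK_ratio_ge R U _ (block_start (segment_code A l))) => //.
    by rewrite /code_point; lia.
  by apply: Xge; exists l.
Qed.

Theorem mainTheorem4 (R : realType) (U : seq bool -> seq bool -> Prop)
    (hU : optimal_prefix_free_machine U) (A B : nat -> bool) :
  turing_le A B <->
  (forall X : nat -> bool, (dim_si R U A X <= dim_si R U B X)%E).
Proof.
split=> [AB X|H]; first exact: dim_si_mono.
apply: contrapT => /(dim_si_separation R hU) [X [leB geA]].
have := le_trans geA (le_trans (H X) leB).
by rewrite lee_fin ler_pdivrMr ?ltr0n // mulrAC ler_pdivlMr ?ltr0n // -!natrM ler_nat.
Qed.
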